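(* Let $N\geq 1$, let $A\in M_N(\mathbb{C})$, let $0<\epsilon<1$, and let $M$ be a real number with $M<\frac{1}{\epsilon}$. If $$\max_{\lambda\in\sigma_\epsilon(A)}|\lambda|>\frac{1+M^2\epsilon}{1-M\epsilon},$$ then $$\sup_{k\geq 0}\|A^k\|>M.$$
   Context: $M_N(\mathbb{C})$ is the algebra of complex $N\times N$ matrices; $\|\cdot\|$ is the Euclidean norm on $\mathbb{C}^N$ and the induced operator norm (spectral norm) on $M_N(\mathbb{C})$. For a scalar $z$, $z-A$ means $zI-A$. For $0<\epsilon<1$ the $\epsilon$-condition spectrum of $A$ is $$\sigma_\epsilon(A)=\{z\in\mathbb{C}: z-A \text{ is not invertible, or } \|(z-A)^{-1}\|\,\|z-A\|\geq 1/\epsilon\}.$$ This set is nonempty and compact, so the maximum exists. The supremum is over integers $k\geq 0$ (with $A^0=I$) and may be $\infty$. *)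

(* Defs.v *)
From HB Require Import structures.
From mathcomp Require Import all_boot all_order all_algebra.
From mathcomp Require Import all_classical all_reals ereal.
From mathcomp Require Import complex.
Set Implicit Arguments.
Unset Strict Implicit.
Unset Printing Implicit Defensive.
Import Order.TTheory GRing.Theory Num.Theory.
Local Open Scope classical_set_scope.
Local Open Scope ring_scope.
Local Open Scope complex_scope.

Import ComplexField.

(* [normc] is the R-valued modulus; the generic norm `|z| takes values in
   R[i]. *)
Definition vnorm (R : realType) (N : nat) (v : 'cV[R[i]]_N) : R :=
  Num.sqrt (\sum_(i < N) Normc.normc (v i ord0) ^+ 2).

Definition opnorm (R : realType) (N : nat) (A : 'M[R[i]]_N) : R :=
  sup [set vnorm (A *m v) | v in [set v : 'cV[R[i]]_N | vnorm v <= 1]].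

Definition condition_spectrum (R : realType) (N : nat) (eps : R)
    (A : 'M[R[i]]_N) : set R[i] :=
  [set z | z%:M - A \notin unitmx \/
           1 / eps <= opnorm (invmx (z%:M - A)) * opnorm (z%:M - A)].

(* For 0 < N and 0 < eps < 1 the condition spectrum is nonempty and compact, so
   this supremum is attained and is the maximum of the moduli. *)
Definition condition_spectral_radius (R : realType) (N : nat) (eps : R)
    (A : 'M[R[i]]_N) : R :=
  sup [set Normc.normc z | z in condition_spectrum eps A].

(* Main.v *)
Require Import Defs.
From HB Require Import structures.
From mathcomp Require Import all_boot all_order all_algebra.
From mathcomp Require Import all_classical all_reals ereal.
From mathcomp Require Import complex.
From mathcomp Require Import ring lra.
Set Implicit Arguments.
Unset Strict Implicit.
Unset Printing Implicit Defensive.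
Import Order.TTheory GRing.Theory Num.Theory.
Local Open Scope classical_set_scope.
Local Open Scope ring_scope.
Local Open Scope complex_scope.

(** Suppose [opnorm (A ^+ k) <= M] for all [k].  Then [M >= 1], and for [1 < |z|]
    the quantity [S = sup_k |A^k v|] satisfies [|z| S <= M |(z - A) v| + S],
    whence [(|z| - 1) |v| <= M |(z - A) v|].  So [z - A] is invertible with
    [|(z - A)^-1| <= M / (|z| - 1)], while [|z - A| <= |z| + M]; if [z] lies in
    the condition spectrum the two bounds give
    [|z| <= (1 + M^2 eps) / (1 - M eps)]. *)

Section EuclideanNorm.

Variables (R : realType) (N : nat).
Implicit Types (v w : 'cV[R[i]]_N).

Lemma vnorm_ge0 v : 0 <= vnorm v.
Proof. exact: sqrtr_ge0. Qed.

Lemma sqr_vnorm v : vnorm v ^+ 2 = \sum_(i < N) Normc.normc (v i ord0) ^+ 2.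
Proof. by rewrite sqr_sqrtr // sumr_ge0 // => i _; rewrite sqr_ge0. Qed.

Lemma normc_ge0 (z : R[i]) : 0 <= Normc.normc z.
Proof. by case: z => a b; apply: sqrtr_ge0. Qed.

Lemma normc_le_vnorm v i : Normc.normc (v i ord0) <= vnorm v.
Proof.
rewrite -(@ler_pXn2r _ 2) ?nnegrE ?vnorm_ge0 ?normc_ge0 // sqr_vnorm.
by rewrite (bigD1 i) //= lerDl sumr_ge0 // => j _; rewrite sqr_ge0.
Qed.

Lemma vnorm0 : vnorm (0 : 'cV[R[i]]_N) = 0.
Proof.
apply/eqP; rewrite -sqrf_eq0 sqr_vnorm big1 // => i _.
by rewrite mxE Normc.normc0 expr0n.
Qed.

Lemma vnorm_eq0 v : (vnorm v == 0) = (v == 0).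
Proof.
apply/eqP/eqP => [v0|->]; last exact: vnorm0.
apply/matrixP => i j; rewrite ord1 mxE; apply: Normc.eq0_normc.
by apply/eqP; rewrite eq_le normc_ge0 -v0 normc_le_vnorm.
Qed.

Lemma vnormZ (a : R[i]) v : vnorm (a *: v) = Normc.normc a * vnorm v.
Proof.
apply/eqP; rewrite -(@eqrXn2 _ 2) ?mulr_ge0 ?vnorm_ge0 ?normc_ge0 //.
rewrite exprMn !sqr_vnorm mulr_sumr; apply/eqP/eq_bigr => i _.
by rewrite mxE Normc.normcM exprMn.
Qed.

(** Weighted convexity of the square, with weights proportional to the two norms, is applied in each
    coordinate and summed; this takes the place of Cauchy-Schwarz. *)
Lemma vnormD v w : vnorm (v + w) <= vnorm v + vnorm w.
Proof.
have [->|v0] := eqVneq v 0; first by rewrite vnorm0 !add0r.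
have [->|w0] := eqVneq w 0; first by rewrite vnorm0 !addr0.
have a0 : 0 < vnorm v by rewrite lt_def vnorm_eq0 v0 vnorm_ge0.
have b0 : 0 < vnorm w by rewrite lt_def vnorm_eq0 w0 vnorm_ge0.
set a := vnorm v in a0 *; set b := vnorm w in b0 *.
(* Convexity of the square: (x + y)^2 <= (a + b) (x^2 / a + y^2 / b). *)
have convex_sqr (x y : R) : (x + y) ^+ 2 <= (a + b) * (a^-1 * x ^+ 2 + b^-1 * y ^+ 2).
  rewrite -subr_ge0.
  have -> : (a + b) * (a^-1 * x ^+ 2 + b^-1 * y ^+ 2) - (x + y) ^+ 2
            = (b * x - a * y) ^+ 2 / (a * b).
    by field; rewrite !gt_eqF.
  by rewrite divr_ge0 ?sqr_ge0 ?mulr_ge0 // ltW.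
rewrite -(@ler_pXn2r _ 2) ?nnegrE ?addr_ge0 ?vnorm_ge0 // sqr_vnorm.
(* In this shape [a ^+ 2] and [b ^+ 2] expand into sums, and the comparison becomes
   coordinatewise. *)
have -> : (a + b) ^+ 2 = (a + b) * (a^-1 * a ^+ 2 + b^-1 * b ^+ 2).
  by field; rewrite !gt_eqF.
rewrite {3}/a {3}/b !sqr_vnorm !mulr_sumr -big_split /= mulr_sumr.
apply: ler_sum => i _; apply: le_trans (convex_sqr _ _).
rewrite ler_pXn2r ?nnegrE ?addr_ge0 ?normc_ge0 // mxE.
exact: le_normcD.
Qed.

Lemma vnormN v : vnorm (- v) = vnorm v.
Proof. by rewrite -scaleN1r vnormZ normcN Normc.normc1 mul1r. Qed.

Lemma vnorm_sum (I : finType) (F : I -> 'cV[R[i]]_N) :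
  vnorm (\sum_i F i) <= \sum_i vnorm (F i).
Proof.
elim/big_ind2: _ => [|v a w b va wb|//]; first by rewrite vnorm0.
exact: le_trans (vnormD _ _) (lerD va wb).
Qed.

End EuclideanNorm.

Section OperatorNorm.

Variables (R : realType) (N : nat).
Implicit Types (A : 'M[R[i]]_N) (v : 'cV[R[i]]_N).

(** [A *m v] combines the columns of [A] with coefficients of modulus at most [vnorm v]. *)
Lemma vnorm_mulmx_bounded A :
  exists C : R, forall v, vnorm (A *m v) <= C * vnorm v.
Proof.
exists (\sum_j vnorm (col j A)) => v.
have -> : A *m v = \sum_j v j ord0 *: col j A.
  apply/matrixP => i k; rewrite ord1 !mxE summxE; apply: eq_bigr => j _.
  by rewrite !mxE mulrC.
apply: le_trans (vnorm_sum _) _; rewrite mulr_suml; apply: ler_sum => j _.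
by rewrite vnormZ mulrC ler_wpM2l ?vnorm_ge0 ?normc_le_vnorm.
Qed.

(** Makes [opnorm] a genuine least upper bound, since [sup] defaults to 0 on unbounded sets. *)
Lemma opnorm_has_sup A :
  has_sup [set vnorm (A *m v) | v in [set v : 'cV[R[i]]_N | vnorm v <= 1]].
Proof.
split; first by exists (vnorm (A *m 0)); exists 0 => //=; rewrite vnorm0.
have [C AC] := vnorm_mulmx_bounded A; exists `|C| => _ [v /= v1 <-].
apply: le_trans (AC v) _; apply: (@le_trans _ _ (`|C| * vnorm v)).
  by rewrite ler_wpM2r ?vnorm_ge0 ?ler_norm.
by rewrite -[leRHS]mulr1 ler_wpM2l.
Qed.

Lemma vnorm_mulmx_le A v : vnorm (A *m v) <= opnorm A * vnorm v.
Proof.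
have [->|v0] := eqVneq v 0; first by rewrite mulmx0 vnorm0 mulr0.
have a0 : 0 < vnorm v by rewrite lt_def vnorm_eq0 v0 vnorm_ge0.
have normc_inv : Normc.normc (vnorm v)^-1%:C = (vnorm v)^-1.
  by rewrite /= expr0n addr0 sqrtr_sqr ger0_norm // invr_ge0 ltW.
rewrite -ler_pdivrMr // mulrC -{1}normc_inv -vnormZ scalemxAr.
apply: sup_upper_bound; first exact: opnorm_has_sup.
by exists ((vnorm v)^-1%:C *: v) => //=; rewrite vnormZ normc_inv mulVf ?gt_eqF.
Qed.

Lemma opnorm_ge0 A : 0 <= opnorm A.
Proof.
apply: le_trans (vnorm_ge0 (A *m 0)) _.
apply: sup_upper_bound; first exact: opnorm_has_sup.
by exists 0 => //=; rewrite vnorm0.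
Qed.

Lemma opnorm_le A (C : R) :
  0 <= C -> (forall v, vnorm (A *m v) <= C * vnorm v) -> opnorm A <= C.
Proof.
move=> C0 AC; apply: ge_sup; first by have [] := opnorm_has_sup A.
move=> _ [v /= v1 <-]; apply: le_trans (AC v) _.
by rewrite -[leRHS]mulr1 ler_wpM2l.
Qed.

Lemma opnorm1_ge1 : (0 < N)%N -> 1 <= opnorm (1%:M : 'M[R[i]]_N).
Proof.
move=> N0; pose v : 'cV[R[i]]_N := const_mx 1.
have v0 : 0 < vnorm v.
  apply: lt_le_trans (normc_le_vnorm v (Ordinal N0)).
  by rewrite mxE Normc.normc1.
by have := vnorm_mulmx_le 1%:M v; rewrite mul1mx ler_pMl.
Qed.

(** A matrix bounded below is injective, hence invertible. [kermx] is a left kernel, so the argument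
    runs on the transpose. *)
Lemma unitmx_lower_bound A (c : R) : 0 < c ->
  (forall v, c * vnorm v <= vnorm (A *m v)) -> A \in unitmx.
Proof.
move=> c0 Ac; rewrite -unitmx_tr -row_free_unit -kermx_eq0.
apply/eqP/row_matrixP => i; rewrite row0; apply: trmx_inj.
rewrite trmx0; apply/eqP; rewrite -vnorm_eq0 eq_le vnorm_ge0 andbT.
rewrite -(pmulr_rle0 _ c0); apply: le_trans (Ac _) _.
by rewrite -{1}[A]trmxK -trmx_mul -row_mul mulmx_ker row0 trmx0 vnorm0.
Qed.

Lemma opnorm_invmx_le A (c : R) : 0 < c ->
  (forall v, c * vnorm v <= vnorm (A *m v)) -> opnorm (invmx A) <= c^-1.
Proof.
move=> c0 Ac; have A_unit := unitmx_lower_bound c0 Ac.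
apply: opnorm_le => [|v]; first by rewrite invr_ge0 ltW.
(* The lower bound is used at the vector [invmx A *m v]. *)
by rewrite ler_pdivlMl // -{2}[v](mulKVmx A_unit) Ac.
Qed.

Lemma opnorm_scalar_sub_le A (z : R[i]) :
  opnorm (z%:M - A) <= Normc.normc z + opnorm A.
Proof.
apply: opnorm_le => [|v]; first by rewrite addr_ge0 ?normc_ge0 ?opnorm_ge0.
rewrite mulmxBl mul_scalar_mx; apply: le_trans (vnormD _ _) _.
by rewrite vnormZ vnormN mulrDl lerD2l vnorm_mulmx_le.
Qed.

Lemma power_bounded_resolvent_bound A (M : R) (z : R[i]) v :
  (forall k, opnorm (A ^+ k) <= M) -> 1 < Normc.normc z ->
  (Normc.normc z - 1) * vnorm v <= M * vnorm ((z%:M - A) *m v).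
Proof.
move=> AM z1; set w := (z%:M - A) *m v.
have powM k u : vnorm (A ^+ k *m u) <= M * vnorm u.
  by apply: le_trans (vnorm_mulmx_le _ _) _; rewrite ler_wpM2r ?vnorm_ge0.
set E := [set vnorm (A ^+ k *m v) | k in [set: nat]].
have E_v : E (vnorm v) by exists 0%N => //; rewrite expr0 mul1mx.
have supE : has_sup E.
  by split; [exists (vnorm v)|exists (M * vnorm v) => _ [k _ <-]].
have vS : vnorm v <= sup E by apply: sup_upper_bound.
have step : sup E <= (M * vnorm w + sup E) / Normc.normc z.
  apply: ge_sup => [|_ [k _ <-]]; first by exists (vnorm v).
  rewrite ler_pdivlMr ?(lt_trans ltr01) // mulrC -vnormZ.
  (* The last term is again an orbit point, so its norm is at most [sup E] whatever [k] is. *)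
  have -> : z *: (A ^+ k *m v) = A ^+ k *m w + A ^+ k.+1 *m v.
    rewrite /w mulmxBl mulmxBr mul_scalar_mx -scalemxAr exprSr.
    by rewrite -mulmxA subrK.
  apply: le_trans (vnormD _ _) (lerD (powM _ _) _).
  by apply: sup_upper_bound => //; exists k.+1.
rewrite ler_pdivlMr ?(lt_trans ltr01) // in step.
(* [vnorm v] is the [k = 0] member of [E]. *)
apply: (@le_trans _ _ ((Normc.normc z - 1) * sup E)).
  by rewrite ler_wpM2l // subr_ge0 ltW.
by rewrite mulrBl mul1r lerBlDr mulrC.
Qed.

End OperatorNorm.

Theorem mainTheorem4 (R : realType) (N : nat) (hN : (1 <= N)%N)
    (A : 'M[R[i]]_N) (eps M : R) (heps0 : 0 < eps) (heps1 : eps < 1)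
    (hM : M < 1 / eps)
    (hmax : (1 + M ^+ 2 * eps) / (1 - M * eps)
              < condition_spectral_radius eps A) :
  (M%:E < ereal_sup [set (opnorm (A ^+ k))%:E | k in [set: nat]])%E.
Proof.
rewrite ltNge; apply/negP => supM.
have AM k : opnorm (A ^+ k) <= M.
  rewrite -lee_fin; apply: le_trans supM.
  by apply: ereal_sup_ubound; exists k.
(* The power [k = 0] is the identity, of norm at least 1 because [N] is positive. *)
have M1 : 1 <= M by apply: le_trans (AM 0%N); exact: opnorm1_ge1.
have Meps : 0 < 1 - M * eps by rewrite subr_gt0 -ltr_pdivlMr.
have M0 : 0 < M := lt_le_trans ltr01 M1.
have bound_gt1 : 1 < (1 + M ^+ 2 * eps) / (1 - M * eps).
  by rewrite ltr_pdivlMr //; nra.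
set E := [set Normc.normc z | z in condition_spectrum eps A].
(* Otherwise [sup E] would be the default 0, below the bound in [hmax], which exceeds 1. *)
have supE : has_sup E.
  apply: contrapT => /sup_out E0; move: hmax.
  by rewrite /condition_spectral_radius -/E E0 ltNge (le_trans _ (ltW bound_gt1)).
have [_ [z z_spec <-] z_gt] := sup_gt supE.1 hmax.
have z1 := lt_trans bound_gt1 z_gt.
have c0 : 0 < (Normc.normc z - 1) / M by rewrite divr_gt0 // subr_gt0.
have lower v : (Normc.normc z - 1) / M * vnorm v <= vnorm ((z%:M - A) *m v).
  by rewrite mulrAC ler_pdivrMr // [leRHS]mulrC power_bounded_resolvent_bound.
case: z_spec => [|]; first by rewrite (unitmx_lower_bound c0 lower).
apply/negP; rewrite -ltNge.
apply: (@le_lt_trans _ _ (((Normc.normc z - 1) / M)^-1 * (Normc.normc z + M))).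
  rewrite ler_pM ?opnorm_ge0 ?(opnorm_invmx_le c0 lower) //.
  apply: le_trans (opnorm_scalar_sub_le _ _) _.
  by rewrite lerD2l -[A]expr1 AM.
(* With denominators cleared, this goal and [z_gt] both say eps M (|z| + M) < |z| - 1. *)
rewrite invf_div mulrAC ltr_pdivrMr ?subr_gt0 // div1r ltr_pdivlMl //.
by rewrite ltr_pdivrMr // in z_gt; lra.
Qed.
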